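(* The axiomatic system $\mathbb{K}^\Delta$ is sound and strongly complete with respect to the class of quasi-filter frames under the semantics $\Vvdash$: for all $\Gamma\cup\{\phi\}\subseteq\mathcal{L}_\Delta$, $\phi$ is derivable from $\Gamma$ in $\mathbb{K}^\Delta$ iff for every model $\mathcal{M}$ based on a quasi-filter frame and every state $s$, if $\mathcal{M},s\Vvdash\psi$ for all $\psi\in\Gamma$ then $\mathcal{M},s\Vvdash\phi$.
   Context: $\mathcal{L}_\Delta$: $\phi::=p\mid\neg\phi\mid(\phi\land\phi)\mid\Delta\phi$, with usual Boolean abbreviations. $\mathbb{K}^\Delta$ has axioms: all propositional tautologies; $\Delta\phi\leftrightarrow\Delta\neg\phi$; $\Delta\top$; $\Delta\phi\land\Delta\psi\to\Delta(\phi\land\psi)$; $\Delta\phi\to\Delta(\phi\to\psi)\vee\Delta(\neg\phi\to\chi)$; rules: modus ponens and from $\phi\leftrightarrow\psi$ infer $\Delta\phi\leftrightarrow\Delta\psi$. Derivability from $\Gamma$ means $\bigwedge\Gamma_0\to\phi$ is a theorem for some finite $\Gamma_0\subseteq\Gamma$. A neighborhood frame $\langle S,N\rangle$ ($S\neq\emptyset$, $N:S\to 2^{2^S}$) is a quasi-filter frame if for every $s\in S$: $S\in N(s)$; $X,Y\in N(s)$ implies $X\cap Y\in N(s)$; $X\in N(s)$ implies $S\setminus X\in N(s)$; and for all $X,Y,Z\subseteq S$, $X\in N(s)$ implies $X\cup Y\in N(s)$ or $(S\setminus X)\cup Z\in N(s)$. Semantics $\Vvdash$: $s\Vvdash p$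 iff $s\in V(p)$, Boolean clauses standard, $\mathcal{M},s\Vvdash\Delta\phi$ iff $\{t:\mathcal{M},t\Vvdash\phi\}\in N(s)$. *)

(* Defs.v *)
From mathcomp Require Import all_boot.
From mathcomp Require Import boolp classical_sets.
From Stdlib Require List.

Set Implicit Arguments.
Unset Strict Implicit.
Unset Printing Implicit Defensive.

Local Open Scope classical_set_scope.

Inductive form (P : Type) : Type :=
| Var (p : P)
| Neg (phi : form P)
| And (phi psi : form P)
| Delta (phi : form P).

Definition Or {P : Type} (phi psi : form P) : form P :=
  Neg (And (Neg phi) (Neg psi)).
Definition Imp {P : Type} (phi psi : form P) : form P :=
  Neg (And phi (Neg psi)).
Definition Iff {P : Type} (phi psi : form P) : form P :=
  And (Imp phi psi) (Imp psi phi).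

(* The language has no propositional constant, so the abbreviation of truth
   rests on a fixed propositional variable [p0]; having one also makes the set
   of variables nonempty, without which there would be no formulas at all. *)
Definition Top {P : Type} (p0 : P) : form P := Or (Var p0) (Neg (Var p0)).

Definition bigAnd {P : Type} (p0 : P) (Gamma : seq (form P)) : form P :=
  foldr (@And P) (Top p0) Gamma.

(* Classical truth tables in which variables and formulas [Delta phi] are all
   treated as independent atoms, so that [tautology] covers every instance in
   the modal language of a propositional tautology. *)
Fixpoint beval {P : Type} (v : P -> bool) (d : form P -> bool) (phi : form P)
    : bool :=
  match phi with
  | Var p => v p
  | Neg phi => ~~ beval v d phi
  | And phi psi => beval v d phi && beval v d psi
  | Delta phi => d phi
  end.

Definition tautology {P : Type} (phi : form P) : Prop :=
  forall (v : P -> bool) (d : form P -> bool), beval v d phi.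

Inductive KDelta {P : Type} (p0 : P) : form P -> Prop :=
| KD_taut phi : tautology phi -> KDelta p0 phi
| KD_equ phi : KDelta p0 (Iff (Delta phi) (Delta (Neg phi)))
| KD_top : KDelta p0 (Delta (Top p0))
| KD_con phi psi :
    KDelta p0 (Imp (And (Delta phi) (Delta psi)) (Delta (And phi psi)))
| KD_dis phi psi chi :
    KDelta p0 (Imp (Delta phi)
                   (Or (Delta (Imp phi psi)) (Delta (Imp (Neg phi) chi))))
| KD_mp phi psi : KDelta p0 (Imp phi psi) -> KDelta p0 phi -> KDelta p0 psi
| KD_re phi psi :
    KDelta p0 (Iff phi psi) -> KDelta p0 (Iff (Delta phi) (Delta psi)).

Definition derivable {P : Type} (p0 : P) (Gamma : set (form P)) (phi : form P)
    : Prop :=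
  exists2 Gamma0 : seq (form P),
    List.Forall Gamma Gamma0 & KDelta p0 (Imp (bigAnd p0 Gamma0) phi).

Record nframe : Type := NFrame {
  state :> Type;
  state_inhabited : [set: state] !=set0;
  nb : state -> set (set state)
}.

Record nmodel (P : Type) : Type := NModel {
  frame_of :> nframe;
  valuation : P -> set frame_of
}.

Fixpoint sat {P : Type} (M : nmodel P) (s : M) (phi : form P) : Prop :=
  match phi with
  | Var p => valuation p s
  | Neg phi => ~ sat s phi
  | And phi psi => sat s phi /\ sat s psi
  | Delta phi => nb s [set t : M | sat t phi]
  end.

Definition quasi_filter (F : nframe) : Prop :=
  forall s : F,
  [/\ nb s [set: F],
      forall X Y : set F, nb s X -> nb s Y -> nb s (X `&` Y),
      forall X : set F, nb s X -> nb s (~` X)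
    & forall X Y Z : set F, nb s X -> nb s (X `|` Y) \/ nb s (~` X `|` Z)].

Definition entails {P : Type} (C : nframe -> Prop) (Gamma : set (form P))
    (phi : form P) : Prop :=
  forall M : nmodel P, C M -> forall s : M,
    (forall psi, Gamma psi -> sat s psi) -> sat s phi.

(* Main.v *)
Require Import Defs.
From mathcomp Require Import all_boot.
From mathcomp Require Import boolp classical_sets.
From Stdlib Require List.

(** Completeness goes through a canonical model. Say that a maximal consistent
    set [m] necessitates [phi] if [Delta (phi \/ psi)] is in [m] for every [psi].
    The formulas necessitated by [m] form a filter, and the last axiom says
    precisely that [Delta phi] is in [m] iff [m] necessitates [phi] or its
    negation. Taking as neighborhoods of [m] the sets which belong, or whose
    complement belongs, to the filter generated by the truth sets of these
    formulas makes the canonical frame a quasi-filter frame. *)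

Set Implicit Arguments.
Unset Strict Implicit.
Unset Printing Implicit Defensive.

Local Open Scope classical_set_scope.

(** * Soundness *)

(** Links satisfaction to truth tables, so that tautologies hold at every state: each atom, variable
    or [Delta]-formula, receives its actual truth value at [s]. *)
Lemma sat_beval {P : Type} (M : nmodel P) (s : M) (phi : form P) :
  sat s phi <-> beval (fun p => `[< valuation p s >])
                      (fun psi => `[< sat s (Delta psi) >]) phi.
Proof.
elim: phi => [p|phi IH|phi IHphi psi IHpsi|phi _] /=.
- by split=> /asboolP.
- by rewrite IH; split=> /negP.
- by rewrite IHphi IHpsi; split=> /andP.
- by split=> /asboolP.
Qed.

Lemma sat_Imp {P : Type} (M : nmodel P) (s : M) (phi psi : form P) :
  sat s (Imp phi psi) <-> (sat s phi -> sat s psi).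
Proof.
split=> /= [h hphi|h [hphi]]; last by apply; exact: h.
by apply: contrapT => hpsi; apply: h.
Qed.

Lemma sat_Iff {P : Type} (M : nmodel P) (s : M) (phi psi : form P) :
  sat s (Iff phi psi) <-> (sat s phi <-> sat s psi).
Proof.
have -> : sat s (Iff phi psi) = (sat s (Imp phi psi) /\ sat s (Imp psi phi)).
  by [].
by rewrite !sat_Imp.
Qed.

Lemma sat_Or {P : Type} (M : nmodel P) (s : M) (phi psi : form P) :
  sat s (Or phi psi) <-> sat s phi \/ sat s psi.
Proof.
split=> /= [h|[h|h] []] //.
by apply: contrapT => /not_orP.
Qed.

Lemma KDelta_sound {P : Type} (p0 : P) (phi : form P) :
  KDelta p0 phi ->
  forall M : nmodel P, quasi_filter M -> forall s : M, sat s phi.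
Proof.
move=> + M qfM; elim=> {phi}.
- by move=> phi taut s; apply/sat_beval; exact: taut.
- move=> phi s; have [_ _ nbC _] := qfM s.
  apply/sat_Iff; split=> [/nbC|/nbC] //=.
  by congr (nb s _); apply/seteqP; split=> t /= => [/contrapT|? /(_ _)].
- move=> s; have [nbT _ _ _] := qfM s => /=.
  suff -> : [set t : M | sat t (Top p0)] = setT by [].
  by apply/seteqP; split=> // t _; apply: (sat_Or t _ _).2; exact: EM.
- move=> phi psi s; have [_ nbI _ _] := qfM s.
  by apply/sat_Imp => -[]; exact: nbI.
- move=> phi psi chi s; have [_ _ _ nbD] := qfM s.
  apply/sat_Imp => nbphi; apply/sat_Or.
  (* The truth set of [chi] goes with that of [phi], and the truth set of [psi] with its complement,
     so the alternatives come in the opposite order to the disjuncts of the axiom. *)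
  have [h|h] := nbD _ [set t : M | sat t chi] [set t : M | sat t psi] nbphi;
    [right|left]; move: h; congr (nb s _); apply/seteqP; split=> t.
  + exact: (sat_Or t phi chi).2.
  + exact: (sat_Or t phi chi).1.
  + by move=> h; apply/sat_Imp; case: h.
  + by move=> /sat_Imp h; have [/h|] := EM (sat t phi); [right|left].
- by move=> phi psi _ IH1 _ IH2 s; apply: (sat_Imp s phi psi).1.
- move=> phi psi _ IH s; apply/sat_Iff => /=.
  suff -> : [set t : M | sat t phi] = [set t : M | sat t psi] by [].
  by apply/seteqP; split=> t /=; have /sat_Iff[] := IH t.
Qed.

Lemma sat_bigAnd {P : Type} (p0 : P) (M : nmodel P) (s : M)
    (G : seq (form P)) :
  List.Forall (sat s) G -> sat s (bigAnd p0 G).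
Proof. by elim=> [|phi G' hphi _ IH] //=; move=> []. Qed.

(** * Truth-table derivations and the deduction theorem *)

Lemma beval_bigAnd {P : Type} (p0 : P) (v : P -> bool) (d : form P -> bool)
    (G : seq (form P)) :
  beval v d (bigAnd p0 G) = all (beval v d) G.
Proof. by elim: G => [|phi G IH] /=; [case: (v p0) | rewrite IH]. Qed.

(** Schematic formulas and lists of hypotheses are treated as opaque booleans, and all their values
    are tried. *)
Ltac truth_table :=
  let v := fresh "v" in let d := fresh "d" in
  move=> v d /=; rewrite ?beval_bigAnd ?all_cat /=;
  repeat match goal with
  | |- context [beval v d ?x] => case: (beval v d x) => //=
  | |- context [all (beval v d) ?x] => case: (all (beval v d) x) => //=
  | |- context [d ?x] => case: (d x) => //=
  | |- context [v ?x] => case: (v x) => //=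
  end.

Lemma KDelta_taut1 {P : Type} (p0 : P) (phi psi : form P) :
  tautology (Imp phi psi) -> KDelta p0 phi -> KDelta p0 psi.
Proof. by move=> /(KD_taut p0); exact: KD_mp. Qed.

Lemma KDelta_taut2 {P : Type} (p0 : P) (phi psi chi : form P) :
  tautology (Imp phi (Imp psi chi)) ->
  KDelta p0 phi -> KDelta p0 psi -> KDelta p0 chi.
Proof. by move=> taut /(KDelta_taut1 taut); exact: KD_mp. Qed.

Lemma derivable_theorem {P : Type} (p0 : P) (Gamma : set (form P))
    (phi : form P) :
  KDelta p0 phi -> derivable p0 Gamma phi.
Proof.
move=> h; exists [::]; first exact: List.Forall_nil.
by apply: KDelta_taut1 h; truth_table.
Qed.

Lemma derivable_hyp {P : Type} (p0 : P) (Gamma : set (form P)) (phi : form P) :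
  Gamma phi -> derivable p0 Gamma phi.
Proof.
move=> h; exists [:: phi]; first by apply: List.Forall_cons.
by apply: KD_taut; truth_table.
Qed.

Lemma derivable_mp {P : Type} (p0 : P) (Gamma : set (form P))
    (phi psi : form P) :
  derivable p0 Gamma (Imp phi psi) -> derivable p0 Gamma phi ->
  derivable p0 Gamma psi.
Proof.
move=> [G1 hG1 h1] [G2 hG2 h2]; exists (G1 ++ G2).
  exact/List.Forall_app.
by apply: KDelta_taut2 h1 h2; truth_table.
Qed.

Lemma derivable_taut2 {P : Type} (p0 : P) (Gamma : set (form P))
    (phi psi chi : form P) :
  tautology (Imp phi (Imp psi chi)) ->
  derivable p0 Gamma phi -> derivable p0 Gamma psi -> derivable p0 Gamma chi.
Proof.
move=> /(KD_taut p0) taut hphi.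
by apply: derivable_mp; apply: derivable_mp hphi; exact: derivable_theorem.
Qed.

Lemma deduction {P : Type} (p0 : P) (Gamma : set (form P)) (phi psi : form P) :
  derivable p0 (phi |` Gamma) psi -> derivable p0 Gamma (Imp phi psi).
Proof.
move=> [G hG h].
(* [G'] is built from [G] by dropping hypotheses equal to [phi]; no induction on derivations is
   required. *)
suff [G' hG' taut] : exists2 G', List.Forall Gamma G' &
    tautology (Imp (And phi (bigAnd p0 G')) (bigAnd p0 G)).
  by exists G' => //; apply: KDelta_taut2 (KD_taut p0 taut) h; truth_table.
elim: hG {h} => [|chi G0 hchi _ [G' hG' taut]].
  by exists [::]; [exact: List.Forall_nil | truth_table].
case: hchi => [->|hchi].
- by exists G' => // v d; move: (taut v d); move: v d; truth_table.
- exists (chi :: G'); first exact: List.Forall_cons.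
  by move=> v d; move: (taut v d); move: v d; truth_table.
Qed.

Lemma derivable0 {P : Type} (p0 : P) (phi : form P) :
  derivable p0 set0 phi -> KDelta p0 phi.
Proof.
move=> [[|psi G] hG]; last by inversion hG.
by apply: KDelta_taut1; truth_table.
Qed.

(** * Maximal consistent sets *)

Definition consistent {P : Type} (p0 : P) (Gamma : set (form P)) : Prop :=
  ~ derivable p0 Gamma (Neg (Top p0)).

(** Maximality is encoded as negation completeness. *)
Definition maxconsistent {P : Type} (p0 : P) (m : set (form P)) : Prop :=
  consistent p0 m /\ forall phi, m phi \/ m (Neg phi).

(** A finite list meets only finitely many members of the chain, and the largest of these suffices.
    The first alternative accounts for the empty chain. *)
Lemma Forall_setU_bigcup {T : Type} (Gamma : set T) (F : set (set T))
    (G : seq T) :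
  total_on F subset -> List.Forall (Gamma `|` \bigcup_(X in F) X) G ->
  List.Forall Gamma G \/ exists2 X, F X & List.Forall (Gamma `|` X) G.
Proof.
move=> totF; elim=> [|x G' hx _ IH]; first by left; exact: List.Forall_nil.
have weaken X Y : X `<=` Y -> List.Forall (Gamma `|` X) G' ->
    List.Forall (Gamma `|` Y) G'.
  by move=> XY; apply: List.Forall_impl => y; exact: setUS.
case: IH => [hG|[X FX hG]]; case: hx => [hx|[Y FY Yx]].
- by left; exact: List.Forall_cons.
- right; exists Y => //; apply: List.Forall_cons; first by right.
  by apply: List.Forall_impl hG => y; left.
- by right; exists X => //; apply: List.Forall_cons => //; left.
- right; have [XY|YX] := totF _ _ FX FY.
    by exists Y => //; apply: List.Forall_cons (weaken _ _ XY hG); right.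
  by exists X => //; apply: List.Forall_cons => //; right; exact: YX.
Qed.

Lemma lindenbaum {P : Type} (p0 : P) (Gamma : set (form P)) :
  consistent p0 Gamma -> exists2 m, maxconsistent p0 m & Gamma `<=` m.
Proof.
move=> conG.
(* Ordering the sets [A] to be added, rather than the extensions of [Gamma], makes the union of the
   empty chain admissible. *)
have [|A [conA maxA]] := @Zorn_bigcup _ [set A | consistent p0 (Gamma `|` A)].
  move=> F conF totF [G /(Forall_setU_bigcup totF)[hG|[X FX hG]] h].
    by apply: conG; exists G.
  by apply: (conF _ FX); exists G.
exists (Gamma `|` A) => //.
(* By maximality of [A], adding a missing formula is inconsistent; the deduction theorem then
   refutes that formula. *)
have der phi : ~ (Gamma `|` A) phi -> derivable p0 (Gamma `|` A) (Neg phi).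
  move=> nphi; apply: contrapT => nder.
  have AphiA : A `<` phi |` A.
    split=> [|/(_ phi) h]; first exact: subsetUr.
    by apply: nphi; right; apply: h; left.
  apply: (maxA _ AphiA); rewrite /= setUCA => h; apply: nder.
  have top : derivable p0 (Gamma `|` A) (Top p0).
    by apply/derivable_theorem/KD_taut; truth_table.
  by apply: derivable_taut2 (deduction h) top; truth_table.
split=> // phi; apply: contrapT => /not_orP[/der h1 /der h2].
by apply: conA; apply: derivable_taut2 h1 h2; truth_table.
Qed.

Lemma maxconsistentE {P : Type} (p0 : P) (m : set (form P)) (phi : form P) :
  maxconsistent p0 m -> m phi <-> derivable p0 m phi.
Proof.
move=> [con tot]; split=> [|h]; first exact: derivable_hyp.
have [//|/(derivable_hyp p0) h'] := tot phi.
by exfalso; apply: con; apply: derivable_taut2 h h'; truth_table.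
Qed.

Lemma maxconsistent_Neg {P : Type} (p0 : P) (m : set (form P))
    (phi : form P) :
  maxconsistent p0 m -> m (Neg phi) <-> ~ m phi.
Proof.
move=> mc; have [con tot] := mc; split=> [h h'|]; last by have [] := tot phi.
apply: con; move: h h' => /(derivable_hyp p0) h /(derivable_hyp p0).
by apply: derivable_taut2 h; truth_table.
Qed.

Lemma maxconsistent_mp {P : Type} (p0 : P) (m : set (form P))
    (phi psi : form P) :
  maxconsistent p0 m -> KDelta p0 (Imp phi psi) -> m phi -> m psi.
Proof.
move=> mc h; rewrite !(maxconsistentE _ mc).
exact/derivable_mp/derivable_theorem.
Qed.

Lemma maxconsistent_And {P : Type} (p0 : P) (m : set (form P))
    (phi psi : form P) :
  maxconsistent p0 m -> m (And phi psi) <-> m phi /\ m psi.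
Proof.
move=> mc; split=> [h|[]].
  by split; apply: (maxconsistent_mp mc) h; apply: KD_taut; truth_table.
by rewrite !(maxconsistentE _ mc); apply: derivable_taut2; truth_table.
Qed.

Lemma maxconsistent_Or {P : Type} (p0 : P) (m : set (form P))
    (phi psi : form P) :
  maxconsistent p0 m -> m (Or phi psi) -> m phi \/ m psi.
Proof.
move=> mc /(maxconsistent_Neg _ mc) h.
apply: contrapT => /not_orP[hphi hpsi]; apply: h.
by apply/(maxconsistent_And _ _ mc); split; apply/(maxconsistent_Neg _ mc).
Qed.

Lemma maxconsistent_Delta {P : Type} (p0 : P) (m : set (form P))
    (phi psi : form P) :
  maxconsistent p0 m -> KDelta p0 (Iff phi psi) -> m (Delta phi) ->
  m (Delta psi).
Proof.
move=> mc equ; apply: (maxconsistent_mp mc).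
by apply: KDelta_taut1 (KD_re equ); truth_table.
Qed.

Lemma nonderivable_maxconsistent {P : Type} (p0 : P) (Gamma : set (form P))
    (phi : form P) :
  ~ derivable p0 Gamma phi ->
  exists m, [/\ maxconsistent p0 m, Gamma `<=` m & ~ m phi].
Proof.
move=> nder.
have [h|m mc sub] := @lindenbaum _ p0 (Neg phi |` Gamma).
  apply: nder.
  have top : derivable p0 Gamma (Top p0).
    by apply/derivable_theorem/KD_taut; truth_table.
  by apply: derivable_taut2 (deduction h) top; truth_table.
exists m; split=> //; first by move=> psi h; apply: sub; right.
by apply/(maxconsistent_Neg _ mc); apply: sub; left.
Qed.

(** Used to turn an inclusion of truth sets in the canonical model into a provable implication. *)
Lemma KDelta_Imp_maxconsistent {P : Type} (p0 : P) (phi psi : form P) :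
  (forall m, maxconsistent p0 m -> m phi -> m psi) -> KDelta p0 (Imp phi psi).
Proof.
move=> h; apply: derivable0; apply: deduction; apply: contrapT.
move=> nder; have [m [mc sub nphi]] := nonderivable_maxconsistent nder.
by apply: nphi; apply: h => //; apply: sub; left.
Qed.

(** * The filter of necessitated formulas *)

Definition necessitates {P : Type} (m : set (form P)) (phi : form P) : Prop :=
  forall psi, m (Delta (Or phi psi)).

Lemma necessitates_Imp {P : Type} (p0 : P) (m : set (form P))
    (phi psi : form P) :
  maxconsistent p0 m -> KDelta p0 (Imp phi psi) -> necessitates m phi ->
  necessitates m psi.
Proof.
(* As [phi] implies [psi], the disjunction of [phi], [psi] and [chi] is equivalent to that of [psi]
   and [chi]. *)
move=> mc h nec chi; apply: (maxconsistent_Delta mc) (nec (Or psi chi)).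
by apply: KDelta_taut1 h; truth_table.
Qed.

Lemma necessitates_Top {P : Type} (p0 : P) (m : set (form P)) :
  maxconsistent p0 m -> necessitates m (Top p0).
Proof.
move=> mc psi; apply: (@maxconsistent_Delta _ p0 _ (Top p0)) => //.
  by apply: KD_taut; truth_table.
exact/(maxconsistentE _ mc)/derivable_theorem/KD_top.
Qed.

Lemma necessitates_And {P : Type} (p0 : P) (m : set (form P))
    (phi psi : form P) :
  maxconsistent p0 m -> necessitates m phi -> necessitates m psi ->
  necessitates m (And phi psi).
Proof.
move=> mc hphi hpsi chi.
(* Disjunction with [chi] distributes over the conjunction, which reduces the goal to the
   conjunction axiom. *)
apply: (@maxconsistent_Delta _ p0 _ (And (Or phi chi) (Or psi chi))) => //.
  by apply: KD_taut; truth_table.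
apply: (maxconsistent_mp mc (KD_con p0 _ _)).
by apply/(maxconsistent_And _ _ mc).
Qed.

Lemma Delta_necessitates {P : Type} (p0 : P) (m : set (form P))
    (phi : form P) :
  maxconsistent p0 m ->
  m (Delta phi) <-> necessitates m phi \/ necessitates m (Neg phi).
Proof.
move=> mc.
have nec_Delta psi : necessitates m psi -> m (Delta psi).
  move=> /(_ psi); apply: (maxconsistent_Delta mc).
  by apply: KD_taut; truth_table.
split=> [h|[/nec_Delta //|/nec_Delta]]; last first.
  apply: (maxconsistent_mp mc); apply: KDelta_taut1 (KD_equ p0 phi).
  by truth_table.
(* A single failure [psi] of necessitation refutes one disjunct of the last axiom, leaving
   [Delta (Imp phi chi)] for arbitrary [chi]. *)
have [|/existsNP[psi npsi]] := EM (necessitates m phi); first by left.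
right=> chi.
(* [Imp (Neg phi) psi] and [Or phi psi] are the same formula. *)
have := maxconsistent_mp mc (KD_dis p0 phi chi psi) h.
move=> /(maxconsistent_Or mc)[|//]; apply: (maxconsistent_Delta mc).
by apply: KD_taut; truth_table.
Qed.

(** * The canonical model *)

Definition canonical_state {P : Type} (p0 : P) : Type :=
  {m : set (form P) | maxconsistent p0 m}.

Definition canonical_filter {P : Type} (p0 : P) (s : canonical_state p0) :
    set (set (canonical_state p0)) :=
  [set X | exists2 phi, necessitates (sval s) phi &
           [set t : canonical_state p0 | sval t phi] `<=` X].

(** [s0] witnesses nonemptiness. *)
Definition canonical_frame {P : Type} (p0 : P) (s0 : canonical_state p0) :
    nframe :=
  @NFrame (canonical_state p0) (ex_intro _ s0 I)
    (fun s => [set X | canonical_filter s X \/ canonical_filter s (~` X)]).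

Definition canonical_model {P : Type} (p0 : P) (s0 : canonical_state p0) :
    nmodel P :=
  @NModel P (canonical_frame s0)
    (fun p => [set s : canonical_state p0 | sval s (Var p)]).

Lemma canonical_filterS {P : Type} (p0 : P) (s : canonical_state p0)
    (X Y : set (canonical_state p0)) :
  X `<=` Y -> canonical_filter s X -> canonical_filter s Y.
Proof.
by move=> XY [phi nec sub]; exists phi => //; exact: subset_trans XY.
Qed.

Lemma canonical_filterI {P : Type} (p0 : P) (s : canonical_state p0)
    (X Y : set (canonical_state p0)) :
  canonical_filter s X -> canonical_filter s Y -> canonical_filter s (X `&` Y).
Proof.
move=> [phi hphi subX] [psi hpsi subY]; exists (And phi psi).
  exact: necessitates_And (svalP s) hphi hpsi.
by move=> t /= /(maxconsistent_And _ _ (svalP t))[/subX ? /subY].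
Qed.

Lemma canonical_quasi_filter {P : Type} (p0 : P) (s0 : canonical_state p0) :
  quasi_filter (canonical_frame s0).
Proof.
move=> s; split=> /=.
- by left; exists (Top p0) => //; exact: necessitates_Top (svalP s).
- move=> X Y [hX|hX] [hY|hY]; first by left; exact: canonical_filterI.
  (* If either complement is in the filter, so is the larger complement of the intersection. *)
  + by right; apply: canonical_filterS hY; by apply: subsetC; exact: subIsetr.
  + by right; apply: canonical_filterS hX; by apply: subsetC; exact: subIsetl.
  + by right; apply: canonical_filterS hX; by apply: subsetC; exact: subIsetl.
- by move=> X; rewrite setCK => -[]; [right|left].
- by move=> X Y Z [h|h]; [left|right]; left; apply: canonical_filterS h;
    exact: subsetUl.
Qed.

(** Upward closure adds no new truth sets: an inclusion between truth sets is a provable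
    implication, along which necessitation is monotone. *)
Lemma canonical_filter_truth {P : Type} (p0 : P) (s : canonical_state p0)
    (phi : form P) :
  canonical_filter s [set t : canonical_state p0 | sval t phi] <->
  necessitates (sval s) phi.
Proof.
split=> [[psi nec sub]|nec]; last by exists phi.
apply: necessitates_Imp (svalP s) _ nec; apply: KDelta_Imp_maxconsistent.
by move=> m mc; exact: (sub (exist _ m mc)).
Qed.

(** Stated as an equality of sets, so that the induction hypothesis rewrites inside a neighborhood
    condition. *)
Lemma canonical_truth {P : Type} (p0 : P) (s0 : canonical_state p0)
    (phi : form P) :
  [set s : canonical_model s0 | sat s phi] =
  [set s : canonical_state p0 | sval s phi].
Proof.
have truthC psi : [set s : canonical_state p0 | sval s (Neg psi)] =
    ~` [set s : canonical_state p0 | sval s psi].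
  by apply/seteqP; split=> s /= /(maxconsistent_Neg _ (svalP s)).
elim: phi => [p|phi IH|phi IHphi psi IHpsi|phi IH].
- by [].
- by rewrite truthC -IH.
- have -> : [set s : canonical_model s0 | sat s (And phi psi)] =
    [set s : canonical_model s0 | sat s phi] `&` [set s | sat s psi] by [].
  rewrite IHphi IHpsi.
  by apply/seteqP; split=> s /= /(maxconsistent_And _ _ (svalP s)).
(* With the complement read as the truth set of [Neg phi], the neighborhood condition becomes the
   criterion of [Delta_necessitates]. *)
- apply/seteqP; split=> s /=; rewrite IH -truthC !canonical_filter_truth;
    exact: (Delta_necessitates _ (svalP s)).1 ||
    exact: (Delta_necessitates _ (svalP s)).2.
Qed.

(** * Soundness and strong completeness *)

Theorem theorem6 (P : Type) (p0 : P) (Gamma : set (form P)) (phi : form P) :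
  derivable p0 Gamma phi <-> entails quasi_filter Gamma phi.
Proof.
split=> [[G hG h] M qfM s satG|ent].
  apply: (sat_Imp s (bigAnd p0 G) phi).1; first exact: KDelta_sound h M qfM s.
  by apply: sat_bigAnd; apply: List.Forall_impl hG; exact: satG.
apply: contrapT => nder.
have [m [mc sub nphi]] := nonderivable_maxconsistent nder.
(* The countermodel is the canonical model at the state [m], which contains [Gamma] but not
   [phi]. *)
pose s : canonical_state p0 := exist _ m mc.
have truth psi : sat (s : canonical_model s) psi = m psi.
  by have /(congr1 (@^~ s)) := canonical_truth s psi.
apply: nphi; rewrite -truth; apply: ent; first exact: canonical_quasi_filter.
by move=> psi /sub; rewrite truth.
Qed.
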